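(* Let $\alpha \in (0,1]$ be rational. For all $\gamma < \alpha$, at least $\Omega(n)$ queries are necessary for every algorithm that makes degree and neighbor queries to an $\alpha$-erased $n$-vertex graph with average degree $\overline{d}$ and outputs, with probability at least $2/3$, an estimate $\widetilde{d} \in [\overline{d}, (1 + \gamma) \overline{d}]$.
   Context: Graphs are simple and undirected, on a vertex set $V$ with $n=|V|$, represented by adjacency lists. For $\alpha\in[0,1]$, an $\alpha$-erased graph is the concatenation of the adjacency lists of a simple undirected graph $(V,E)$ in which at most $2\alpha|E|$ entries have been replaced by a special symbol $\bot$ (erased). $m$ denotes half the total length of all adjacency lists and $\overline{d}=2m/n$ is the average degree. A degree query on $v$ returns the length of its adjacency list; a neighbor query $(v,i)$ returns the $i$-th entry of the adjacency list of $v$ (possibly $\bot$). *)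

(* Defs.v *)
From HB Require Import structures.
From mathcomp Require Import all_boot all_order all_algebra.
From mathcomp Require Import all_classical all_reals all_analysis.

Set Implicit Arguments.
Unset Strict Implicit.
Unset Printing Implicit Defensive.

Import Order.TTheory GRing.Theory Num.Theory.
Local Open Scope ring_scope.

Definition simple_graph (V : finType) (E : {set {set V}}) : Prop :=
  forall e, e \in E -> #|e| = 2%N.

(* The order of the neighbors within each list is arbitrary. *)
Definition adjacency_lists (V : finType) (E : {set {set V}})
    (L : V -> seq V) : Prop :=
  forall v, uniq (L v) /\ forall u, (u \in L v) = ([set u; v] \in E).

(* Adjacency lists with erasures: an entry [None] is the erased symbol. *)
Definition erased_lists (V : finType) : Type := V -> seq (option V).

(* [all2] also forces the two lists to have the same length. *)
Definition erasure_of (V : finType) (L : V -> seq V)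
    (x : erased_lists V) : Prop :=
  forall v, all2 (fun o u => (o == None) || (o == Some u)) (x v) (L v).

Definition num_erased (V : finType) (x : erased_lists V) : nat :=
  (\sum_(v : V) count_mem None (x v))%N.

Definition erased_graph (R : realType) (alpha : R) (V : finType)
    (x : erased_lists V) : Prop :=
  exists (E : {set {set V}}) (L : V -> seq V),
    [/\ simple_graph E, adjacency_lists E L, erasure_of L x &
        (num_erased x)%:R <= 2 * alpha * #|E|%:R].

Definition num_edges (R : realType) (V : finType) (x : erased_lists V) : R :=
  (\sum_(v : V) size (x v))%N%:R / 2.

Definition avg_degree (R : realType) (V : finType) (x : erased_lists V) : R :=
  2 * num_edges R x / #|V|%:R.

(* A deterministic adaptive algorithm on vertex set [V] with outputs in [O],
   as a well-founded decision tree. The answer to a neighbor query is [None]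
   beyond the end of the list, [Some None] on an erased entry, and
   [Some (Some u)] on an entry [u]; list positions are numbered from 0. *)
Inductive algorithm (V : finType) (O : Type) : Type :=
| Output of O
| DegreeQuery of V & (nat -> algorithm V O)
| NeighborQuery of V & nat & (option (option V) -> algorithm V O).

Fixpoint output (V : finType) (O : Type) (A : algorithm V O)
    (x : erased_lists V) : O :=
  match A with
  | Output o => o
  | DegreeQuery v k => output (k (size (x v))) x
  | NeighborQuery v i k => output (k (onth (x v) i)) x
  end.

Fixpoint queries (V : finType) (O : Type) (A : algorithm V O)
    (x : erased_lists V) : nat :=
  match A with
  | Output _ => 0
  | DegreeQuery v k => (queries (k (size (x v))) x).+1
  | NeighborQuery v i k => (queries (k (onth (x v) i)) x).+1
  end.

(* A randomized algorithm is a family of deterministic ones indexed by the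
   outcomes of a probability space, with a measurable output on every input. *)
Definition randomized_algorithm (R : realType) (V : finType)
    (d : measure_display) (T : measurableType d)
    (A : T -> algorithm V R) : Prop :=
  forall x, measurable_fun [set: T]%classic (fun w => output (A w) x).

Definition estimates_avg_degree (R : realType) (alpha gamma : R) (V : finType)
    (d : measure_display) (T : measurableType d) (P : probability T R)
    (A : T -> algorithm V R) : Prop :=
  forall x : erased_lists V, erased_graph alpha x ->
    ((2 / 3 : R)%:E <=
     P [set w | (avg_degree R x <= output (A w) x
                   <= (1 + gamma) * avg_degree R x)%R]%classic)%E.

Definition makes_at_most (R : realType) (alpha : R) (V : finType)
    (d : measure_display) (T : measurableType d)
    (A : T -> algorithm V R) (q : nat) : Prop :=
  forall x : erased_lists V, erased_graph alpha x ->
  forall w : T, (queries (A w) x <= q)%N.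

(* Main.v *)
(* Let alpha = s / r.  Let x be a perfect matching on a set C of 2r vertices in
   which both entries of each of s pairs are erased, all other vertices being
   isolated, and for h outside C let y_h be the same lists with h adjacent to
   all 2s vertices D whose entry is erased.  The total length of the lists is
   |C| in x and (1 + alpha) |C| in y_h, so since gamma < alpha no output is
   correct for both; but x and y_h differ only in the list of h, so an algorithm
   with the same random outcome can answer correctly on both only if it queries
   h on x.  This has probability at least 1/3 for each h outside C, while at
   most q vertices are queried on x, hence (n - 2r) / 3 <= q. *)

Require Import Defs.
From HB Require Import structures.
From mathcomp Require Import all_boot all_order all_algebra.
From mathcomp Require Import all_classical all_reals all_analysis.
From mathcomp Require Import measurable_realfun lra zify.

Set Implicit Arguments.
Unset Strict Implicit.
Unset Printing Implicit Defensive.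

Import Order.TTheory GRing.Theory Num.Theory.
Local Open Scope ring_scope.

(** * Queried vertices of a decision tree *)

Fixpoint queried (V : finType) (O : Type) (A : algorithm V O)
    (x : erased_lists V) : seq V :=
  match A with
  | Output _ => [::]
  | DegreeQuery v k => v :: queried (k (size (x v))) x
  | NeighborQuery v i k => v :: queried (k (onth (x v) i)) x
  end.

Lemma size_queried (V : finType) (O : Type) (A : algorithm V O)
    (x : erased_lists V) : size (queried A x) = queries A x.
Proof. by elim: A => //= [v k IH|v i k IH]; rewrite IH. Qed.

(** By induction on the tree: the first query gets the same answer on both inputs, so both runs
    enter the same subtree. Only the run on [x] has to be inspected. *)
Lemma eq_output (V : finType) (O : Type) (A : algorithm V O)
    (x y : erased_lists V) :
  {in queried A x, x =1 y} -> output A x = output A y.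
Proof.
elim: A => //= [v k IH|v i k IH] xy.
  by rewrite -xy ?mem_head// IH// => u ku; apply: xy; rewrite inE ku orbT.
by rewrite -xy ?mem_head// IH// => u ku; apply: xy; rewrite inE ku orbT.
Qed.

(** * Handshake identity and recognition of erased graphs *)

Lemma sum_size_adjacency_lists (V : finType) (E : {set {set V}})
    (L : V -> seq V) :
  simple_graph E -> adjacency_lists E L ->
  (\sum_(v : V) size (L v) = 2 * #|E|)%N.
Proof.
move=> sE aL.
(* For fixed [v], the map from [u] to [[set u; v]] is a bijection from [L v] onto the edges
   containing [v]; exchanging the sums then counts each edge twice. *)
have szL v : size (L v) = (\sum_(e in E) (v \in e))%N.
  have [uL mL] := aL v.
  rewrite -big_mkcondr sum1dep_card -(card_uniqP uL).
  have inj : {in L v &, injective (fun u => [set u; v])}.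
    move=> u u'; rewrite !mL => /sE cu /sE cu' /setP /(_ u).
    move: cu; rewrite cards2 !inE eqxx /= => /eqP; rewrite eqSS eqb1 => uv.
    by rewrite (negbTE uv) orbF => /esym/eqP.
  rewrite -(card_in_image inj); apply: eq_card => e.
  rewrite inE; apply/fintype.imageP/andP => [[u + ->]|[eE ve]].
    by rewrite mL => uE; rewrite uE !inE eqxx orbT.
  have : #|e| == 2%N by rewrite (sE _ eE).
  case/cards2P => a [b [ab eab]].
  move: ve eE; rewrite eab !inE => /orP[]/eqP vE eE; subst v.
    by exists b; rewrite ?mL finset.setUC.
  by exists a; rewrite ?mL.
under eq_bigr do rewrite szL.
rewrite exchange_big /= mulnC -sum_nat_const; apply: eq_bigr => e /sE <-.
by rewrite -big_mkcond /= sum1_card.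
Qed.

(** The edges are read off the symmetric, irreflexive lists [L]. The handshake identity turns the
    erasure budget into [alpha] times the total list length, so no edge has to be counted later. *)
Lemma erased_graphI (R : realType) (alpha : R) (V : finType)
    (L : V -> seq V) (x : erased_lists V) :
  (forall v, uniq (L v)) -> (forall v, v \notin L v) ->
  (forall u v, u \in L v -> v \in L u) -> erasure_of L x ->
  (num_erased x)%:R <= alpha * (\sum_v size (x v))%N%:R ->
  erased_graph alpha x.
Proof.
move=> uL irL symL Lx le_er.
pose E := [set [set p.1; p.2] | p in [pred p : V * V | p.1 \in L p.2]].
have sE : simple_graph E.
  move=> _ /imsetP[[u v] /=+ ->]; rewrite inE /= cards2 => uv.
  by case: eqVneq uv => // ->; rewrite (negbTE (irL v)).
have aL : adjacency_lists E L.
  move=> v; split=> // u; apply/idP/imsetP => [uv|[[a b]]].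
    by exists (u, v).
  rewrite inE /= => ab uvab.
  have ne : a != b by apply: contraTneq ab => ->.
  have : a \in [set u; v] by rewrite uvab !inE eqxx.
  have : b \in [set u; v] by rewrite uvab !inE eqxx orbT.
  rewrite !inE => /orP[]/eqP bE /orP[]/eqP aE; subst a b => //.
  - by rewrite eqxx in ne.
  - exact: symL.
  - by rewrite eqxx in ne.
exists E, L; split=> //.
rewrite [2 * alpha]mulrC -mulrA -natrM -(sum_size_adjacency_lists sE aL).
congr (_ <= _ * _%:R): le_er; apply: eq_bigr => v _.
by have := Lx v; rewrite all2E => /andP[/eqP].
Qed.

(** * Two bounds on probabilities of events *)

Section Probability.
Local Open Scope ereal_scope.

(** Splitting [X] along [Y] bounds [P X] by [1 - P Y] plus the probability of the intersection. *)
Lemma probability_setI_ge d (T : measurableType d) (R : realType)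
    (P : probability T R) (X Y : set T) (a b : R) :
  measurable X -> measurable Y -> a%:E <= P X -> b%:E <= P Y ->
  (a + b - 1)%:E <= P (X `&` Y)%classic.
Proof.
move=> mX mY aX bY.
have mI : measurable (X `&` Y)%classic by exact: measurableI.
have : P X <= P (~` Y)%classic + P (X `&` Y)%classic.
  rewrite (measureDI P mX mY) leeD2r// setDE le_measure ?inE//.
  - by apply: measurableI => //; exact: measurableC.
  - exact: measurableC.
rewrite probability_setC// => le; have := le_trans aX le.
have := bY; have := fin_num_measure P _ mI; have := fin_num_measure P _ mY.
case: (P Y) => // y _; case: (P (_ `&` _)%classic) => [z| |] // _; last first.
  by move=> *; rewrite leey.
rewrite -EFinB -EFinD !lee_fin; lra.
Qed.

(** The left side is the expected number of events that occur, and this number never exceeds [q]. *)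
Lemma sum_probability_le d (T : measurableType d) (R : realType)
    (P : probability T R) (I : finType) (D : {set I}) (X : I -> set T)
    (q : nat) :
  (forall i, measurable (X i)) ->
  (forall w, (\sum_(i in D) (w \in X i) <= q)%N) ->
  \sum_(i in D) P (X i) <= q%:R%:E.
Proof.
move=> mX leq.
have -> : \sum_(i in D) P (X i) =
    \int[P]_w (\sum_(i <- enum D) (\1_(X i) w : R)%:E).
  rewrite ge0_integral_sum//; last first.
    by move=> i; apply/measurable_EFinP; exact: measurable_indic.
  rewrite big_enum /=; apply: eq_bigr => i _.
  by rewrite integral_indic// setIT.
rewrite -[leRHS]mule1 -(probability_setT P) -integral_cst//.
apply: ge0_le_integral => //.
- by move=> w _; apply: sume_ge0 => i _; rewrite lee_fin.
- apply: emeasurable_sum => i.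
  by apply/measurable_EFinP; exact: measurable_indic.
- move=> w _; rewrite sumEFin lee_fin /= big_enum /=.
  under eq_bigr do rewrite indicE.
  by rewrite -natr_sum ler_nat.
Qed.
End Probability.

(** * Matchings with erased pairs, and stars reusing the erased entries *)

Definition matching_on (V : finType) (C : {set V}) (p : V -> V) : Prop :=
  {in C, forall v, [/\ p v \in C, p v != v & p (p v) = v]}.

Lemma exists_matching (V : finType) (a b : nat) : (2 * (a + b) <= #|V|)%N ->
  exists (A C : {set V}) (p : V -> V),
    [/\ A \subset C, #|A| = (2 * a)%N, #|C| = (2 * (a + b))%N,
        matching_on C p & matching_on A p].
Proof.
(* An element of [I] is a pair's label with a flag for one of its two ends; [p] flips the flag. [A]
   collects the pairs labelled in ['I_a], hence is closed under [p]. *)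
pose I : finType := ((('I_a + 'I_b) * bool)%type : finType).
have cI : #|I| = (2 * (a + b))%N.
  by rewrite card_prod card_sum !card_ord card_bool mulnC.
rewrite -cI => leI.
pose f (i : I) : V := enum_val (widen_ord leI (enum_rank i)).
have f_inj : injective f.
  by move=> i j /enum_val_inj/(congr1 val)/= /val_inj/enum_rank_inj.
pose p v := if [pick i | f i == v] is Some i then f (i.1, ~~ i.2) else v.
have pf i : p (f i) = f (i.1, ~~ i.2).
  rewrite /p; case: pickP => [j /eqP/f_inj -> //|/(_ i)].
  by rewrite eqxx.
have pP i : p (f i) != f i /\ p (p (f i)) = f i.
  split; last by rewrite !pf /= negbK -surjective_pairing.
  by rewrite pf (inj_eq f_inj) -pair_eqE /= eqxx /=; case: i.2.
pose g (i : 'I_a * bool) : V := f (inl i.1, i.2).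
have g_inj : injective g by move=> [i c] [j c'] /f_inj[-> ->].
exists [set g i | i : 'I_a * bool], [set f i | i : I], p; split.
- apply/fintype.subsetP => v /imsetP[i _ ->]; apply/imsetP.
  by exists (inl i.1, i.2); rewrite ?inE.
- by rewrite card_imset// card_prod card_ord card_bool mulnC.
- by rewrite card_imset// cI.
- move=> _ /imsetP[i _ ->]; have [? ?] := pP i; split => //.
  by rewrite pf imset_f.
- move=> _ /imsetP[i _ ->]; have [? ?] := pP (inl i.1, i.2); split => //.
  by rewrite pf; apply/imsetP; exists (i.1, ~~ i.2).
Qed.

Definition erased_matching (V : finType) (A C : {set V}) (p : V -> V) :
    erased_lists V :=
  fun v => if v \in A then [:: None] else if v \in C then [:: Some (p v)]
           else [::].

(** The lists on [A] stay as in the matching: their erased entry now stands for [h] instead of the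
    partner. *)
Definition erased_star (V : finType) (A C : {set V}) (p : V -> V) (h : V) :
    erased_lists V :=
  fun v => if v == h then [seq Some u | u <- enum A]
           else erased_matching A C p v.

Lemma sum_size_erased_matching (V : finType) (A C : {set V}) (p : V -> V) :
  A \subset C -> (\sum_v size (erased_matching A C p v) = #|C|)%N.
Proof.
move=> /fintype.subsetP sAC; rewrite -sum1_card [RHS]big_mkcond.
apply: eq_bigr => v _.
by rewrite /erased_matching; case: ifP => [/sAC ->|_]; last case: ifP.
Qed.

Lemma num_erased_matching (V : finType) (A C : {set V}) (p : V -> V) :
  num_erased (erased_matching A C p) = #|A|.
Proof.
rewrite -sum1_card [RHS]big_mkcond; apply: eq_bigr => v _.
by rewrite /erased_matching; case: ifP => // _; case: ifP.
Qed.

Lemma sum_size_erased_star (V : finType) (A C : {set V}) (p : V -> V) (h : V) :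
  A \subset C -> h \notin C ->
  (\sum_v size (erased_star A C p h v) = #|A| + #|C|)%N.
Proof.
move=> sAC hC; rewrite -(sum_size_erased_matching p sAC).
rewrite (bigD1 h)//= [in RHS](bigD1 h)//= /erased_star eqxx.
rewrite size_map -cardE {2}/erased_matching (negbTE hC).
rewrite (contraNF (fintype.subsetP sAC h))//; congr addn.
by apply: eq_bigr => v /negbTE ->.
Qed.

Lemma num_erased_star (V : finType) (A C : {set V}) (p : V -> V) (h : V) :
  A \subset C -> h \notin C -> num_erased (erased_star A C p h) = #|A|.
Proof.
move=> sAC hC; rewrite -(num_erased_matching A C p) /num_erased.
rewrite (bigD1 h)//= [in RHS](bigD1 h)//= /erased_star eqxx.
rewrite count_map {2}/erased_matching (negbTE hC).
rewrite (contraNF (fintype.subsetP sAC h))//=.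
rewrite (eq_count (a2 := pred0)) ?count_pred0//.
by congr addn; apply: eq_bigr => v /negbTE ->.
Qed.

Lemma erased_graph_matching (R : realType) (alpha : R) (V : finType)
    (A C : {set V}) (p : V -> V) :
  A \subset C -> matching_on C p -> #|A|%:R <= alpha * #|C|%:R ->
  erased_graph alpha (erased_matching A C p).
Proof.
move=> sAC pC leAC.
apply: (@erased_graphI _ _ _ (fun v => if v \in C then [:: p v] else [::])).
- by move=> v; case: ifP.
- move=> v; case: ifP => // vC; rewrite inE eq_sym.
  by have [] := pC _ vC.
- move=> u v; case: ifP => // vC; rewrite inE => /eqP ->.
  by have [-> _ ->] := pC _ vC; rewrite mem_head.
- move=> v; rewrite /erased_matching.
  case: ifP => [/(fintype.subsetP sAC) ->//|_].
  by case: ifP => //= _; rewrite eqxx.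
- by rewrite num_erased_matching sum_size_erased_matching.
Qed.

(** The underlying graph is the star from [h] to [A] together with the matching on the rest of [C].
    Since [p] preserves both [C] and [A], it also preserves that rest. *)
Lemma erased_graph_star (R : realType) (alpha : R) (V : finType)
    (A C : {set V}) (p : V -> V) (h : V) :
  A \subset C -> h \notin C -> matching_on C p -> matching_on A p ->
  #|A|%:R <= alpha * (#|A| + #|C|)%N%:R ->
  erased_graph alpha (erased_star A C p h).
Proof.
move=> sAC hC pC pA leAC.
have hA : h \notin A by apply: contraNN hC; exact: fintype.subsetP.
have pNA v : v \in C -> v \notin A -> p v \notin A.
  move=> vC; apply: contraNN => /pA[+ _ _].
  by have [_ _ ->] := pC _ vC.
pose L v := if v == h then enum A else if v \in A then [:: h]
            else if v \in C then [:: p v] else [::].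
apply: (@erased_graphI _ _ _ L); rewrite /L.
- by move=> v; case: (v == h); [exact: enum_uniq|case: ifP => //; case: ifP].
- move=> v; case: eqP => [->|/eqP vh]; first by rewrite mem_enum.
  case: ifP => [_|_]; first by rewrite inE.
  case: ifP => // vC; rewrite inE eq_sym.
  by have [] := pC _ vC.
- move=> u v; case: eqP => [->|/eqP vh].
    rewrite mem_enum => uA; rewrite uA; case: eqP => [uh|_].
      by rewrite -uh uA in hA.
    by rewrite mem_head.
  case: ifPn => [vA|vA].
    by rewrite inE => /eqP ->; rewrite eqxx mem_enum.
  case: ifP => // vC; rewrite inE => /eqP ->.
  have [pvC _ ppv] := pC _ vC; rewrite (negbTE (pNA _ vC vA)) pvC ppv.
  case: eqP => [pvh|_]; last by rewrite mem_head.
  by rewrite -pvh pvC in hC.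
- move=> v; rewrite /erased_star; case: eqP => _.
    by elim: (enum A) => //= u s ->; rewrite eqxx.
  rewrite /erased_matching; case: ifP => // _.
  by case: ifP => //= _; rewrite eqxx.
- by rewrite num_erased_star// sum_size_erased_star.
Qed.

(** * From the two inputs to the query bound *)

Lemma avg_degreeE (R : realType) (V : finType) (x : erased_lists V) :
  avg_degree R x = (\sum_v size (x v))%N%:R / #|V|%:R.
Proof. by rewrite /avg_degree /num_edges mulrCA divff ?mulr1// pnatr_eq0. Qed.

(** Numerator and denominator provide the sizes of the construction: [2 * s] erased entries among
    [2 * r] make the erased fraction exactly [alpha]. *)
Lemma ratr_fraction_le1 (R : realType) (alpha : rat) :
  0 < alpha -> alpha <= 1 ->
  exists s r : nat, [/\ (0 < r)%N, (s <= r)%N & ratr alpha = s%:R / r%:R :> R].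
Proof.
move=> a_gt0 a_le1; exists `|numq alpha|%N, `|denq alpha|%N.
have n0 : 0 <= numq alpha by rewrite numq_ge0 ltW.
have E : ratr alpha = `|numq alpha|%N%:R / `|denq alpha|%N%:R :> R.
  by rewrite /ratr !natr_absz !ger0_norm// denq_ge0.
have d_gt0 : (0 < `|denq alpha|)%N by rewrite absz_gt0 denq_neq0.
split=> //; rewrite -(ler_nat R) -[leRHS]mul1r -ler_pdivrMr ?ltr0n// -E.
by rewrite -(rmorph1 (@ratr R)) ler_rat.
Qed.

Lemma measurable_between (R : realType) d (T : measurableType d) (f : T -> R)
    (a b : R) : measurable_fun [set: T]%classic f ->
  measurable [set w | a <= f w <= b]%classic.
Proof.
move=> mf; have := mf measurableT _ (measurable_itv `[a, b]).
rewrite setTI; congr (measurable _).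
Qed.

Theorem theorem1p5 (R : realType) (alpha : rat) (gamma : R)
    (alpha_gt0 : 0 < alpha) (alpha_le1 : alpha <= 1)
    (gamma_lt : gamma < ratr alpha) :
  exists2 c : R, 0 < c & exists n0 : nat,
    forall V : finType, (n0 <= #|V|)%N ->
    forall (d : measure_display) (T : measurableType d) (P : probability T R)
           (A : T -> algorithm V R) (q : nat),
      randomized_algorithm A ->
      estimates_avg_degree (ratr alpha) gamma P A ->
      makes_at_most (ratr alpha) A q ->
      c * #|V|%:R <= q%:R.
Proof.
have [s [r [r_gt0 le_sr alphaE]]] := ratr_fraction_le1 R alpha_gt0 alpha_le1.
(* The factor [1 / 6] is the probability [1 / 3] times the fraction [1 / 2] of vertices outside [C],
   guaranteed by [4 * r <= #|V|] and [#|C| = 2 * r]. *)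
exists (1 / 6); first by lra.
exists (4 * r)%N => V leV d T P A q mA estA qA.
have [|D [C [p [sDC cD cC pC pD]]]] := @exists_matching V s (r - s).
  by rewrite subnKC//; lia.
rewrite subnKC// in cC.
have cDC : (#|D|%:R : R) = ratr alpha * #|C|%:R.
  have r0 : (r%:R : R) != 0 by rewrite pnatr_eq0 -lt0n.
  by rewrite alphaE cD cC !natrM [_ * r%:R]mulrC mulrA divfK// mulrC.
have alpha_ge0 : 0 <= ratr alpha :> R by rewrite ler0q ltW.
pose x := erased_matching D C p; pose y := erased_star D C p.
have xE : erased_graph (ratr alpha : R) x.
  by apply: erased_graph_matching => //; rewrite cDC.
have yE h : h \in ~: C -> erased_graph (ratr alpha : R) (y h).
  rewrite inE => hC; apply: erased_graph_star => //.
  by rewrite natrD mulrDr -cDC lerDr mulr_ge0.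
(* The event that one random outcome is correct on both inputs. *)
pose X h := ([set w | avg_degree R x <= output (A w) x
                       <= (1 + gamma) * avg_degree R x] `&`
            [set w | avg_degree R (y h) <= output (A w) (y h)
                       <= (1 + gamma) * avg_degree R (y h)])%classic.
have mX h : measurable (X h).
  by apply: measurableI; exact: measurable_between.
have PX h : h \in ~: C -> ((1 / 3 : R)%:E <= P (X h))%E.
  move=> hC; have -> : 1 / 3 = 2 / 3 + 2 / 3 - 1 :> R by lra.
  by apply: probability_setI_ge; [exact: measurable_between..| |];
    apply: estA => //; exact: yE.
(* For [w] in [X h], the vertex [h] occurs in [queried (A w) x], and a list has at most as many
   distinct members as its length. *)
have Xq w : (\sum_(h in ~: C) (w \in X h) <= q)%N.
  apply: leq_trans (qA x xE w); rewrite -size_queried.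
  apply: leq_trans (card_size _); rewrite -sum1_card.
  rewrite big_mkcond [leqRHS]big_mkcond; apply: leq_sum => h _.
  case: ifP => // hC; case: (boolP (w \in X h)) => //.
  rewrite in_setE => -[/andP[_ xle] /andP[yle _]].
  case: ifPn => // hq; exfalso.
  have : output (A w) x = output (A w) (y h).
    apply: eq_output => v vq; rewrite /y /erased_star.
    by case: eqP => // vh; rewrite -vh vq in hq.
  (* A common output would give [avg_degree R (y h) <= (1 + gamma) * avg_degree R x]; cancelling
     [#|V|] and [#|C|], both positive as [0 < r], leaves [1 + alpha <= 1 + gamma]. *)
  move=> oE; have := le_trans yle (eq_ind _ (fun o => o <= _) xle _ oE).
  rewrite inE in hC.
  rewrite !avg_degreeE sum_size_erased_star// sum_size_erased_matching//.
  rewrite mulrA ler_pM2r ?invr_gt0 ?ltr0n; last by lia.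
  rewrite natrD cDC -{2}[#|C|%:R]mul1r -mulrDl ler_pM2r ?ltr0n ?cC; last by lia.
  by move: gamma_lt; lra.
have := sum_probability_le P mX Xq.
have : (\sum_(h in ~: C) (1 / 3 : R)%:E <= \sum_(h in ~: C) P (X h))%E.
  exact: lee_sum.
move=> /le_trans/[apply]; rewrite sumEFin lee_fin sumr_const.
apply: le_trans; rewrite -mulr_natr.
have : (#|V|%:R : R) <= 2 * #|~: C|%:R.
  by rewrite -natrM ler_nat; have := cardsC C; lia.
lra.
Qed.
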